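(* Let $\mathcal{X}\subset\mathbb{R}^d$ ($d\ge 2$), let $\mathcal{F}=\{f_\theta:\theta\in\Omega_\theta\}$ be a class of real-valued bounded measurable functions on $\mathcal{X}$, given by a parametric defining function $f_\theta(x)$ on $\mathcal{X}\times\Omega_\theta$ with $\Omega_\theta\subseteq\mathbb{R}^n\setminus\{0\}$, let $\xi(\cdot,\cdot)$ be a metric for one-dimensional probability measures, and let $r\ge 1$. For probability measures $\mu,\nu$ on $\mathcal{X}$ with respective densities $p,q$, define the generalized sliced probability metric (GSPM) $$\zeta_{\mathcal{F}}(p,q):=\Bigl(\int_{\Omega_\theta}\xi^r(p_{f_\theta},q_{f_\theta})\,d\theta\Bigr)^{1/r},$$ where $p_{f_\theta}$ is the slice of $p$ with respect to $f_\theta$. Then $\zeta_{\mathcal{F}}$ is non-negative, symmetric, satisfies the triangle inequality $\zeta_{\mathcal{F}}(p,q)\le\zeta_{\mathcal{F}}(p,h)+\zeta_{\mathcal{F}}(h,q)$, and $p=q$ implies $\zeta_{\mathcal{F}}(p,q)=0$. If the generalized Radon transform $p\mapsto\{p_{f_\theta}\}_{\theta\in\Omega_\theta}$ is injective, then $\zeta_{\mathcal{F}}$ is a metric (in addition, $\zeta_{\mathcal{F}}(p,q)=0$ implies $p=q$); otherwise, $\zeta_{\mathcal{F}}$ is a pseudo-metric.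
   Context: The slice of a probability density $p$ on $\mathcal{X}$ (the density of a probability measure $\mu$) with respect to a function $f:\mathcal{X}\to\mathbb{R}$ is the one-dimensional probability density $p_f(\cdot)=\int_{\mathcal{X}}p(x)\,\delta(\cdot-f(x))\,dx$, where $\delta$ is the one-dimensional Dirac function; equivalently it is the pushforward measure $f_\#\mu$, the distribution of $f(x)$ when $x\sim p$. The generalized Radon transform associated with $\mathcal{F}$ sends $p$ to the family of all its slices $\{p_{f_\theta}:\theta\in\Omega_\theta\}$. The integral over $\Omega_\theta$ is the expected value of $\xi^r(p_{f_\theta},q_{f_\theta})$ when $\theta$ is uniformly distributed on $\Omega_\theta$.
   Formalization: Injectivity is taken as: slices equal for almost every θ imply p=q a.e. (with every θ the claim fails: let f_θ=0 off one null θ where f_θ is injective). The integrand is assumed measurable in θ; ζ may be +∞, and is called a real-valued (pseudo-)metric when finite. *)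

(* Defs.v *)
From HB Require Import structures.
From mathcomp Require Import all_boot all_order all_algebra.
From mathcomp Require Import all_classical all_reals all_analysis.
From mathcomp Require Import measurable_realfun.

Set Implicit Arguments.
Unset Strict Implicit.
Unset Printing Implicit Defensive.
Import Order.TTheory GRing.Theory Num.Theory.
Import numFieldNormedType.Exports.

Local Open Scope classical_set_scope.
Local Open Scope ring_scope.

(** Tuples rather than ['rV[R]_n], which has no measurable structure and whose
    norm is the sup norm. The sigma-algebra is the product, i.e. Borel, one. *)
Notation Euclid R n := (n.-tuple R).

(** ** Pseudo-metrics and metrics, relative to an equality [E] on [T] *)

Record is_pseudometric (R : realType) (T : Type) (E : T -> T -> Prop)
    (D : T -> T -> R) : Prop := IsPseudometric {
  pseudometric_ge0 : forall x y, 0 <= D x y;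
  pseudometric_sym : forall x y, D x y = D y x;
  pseudometric_triangle : forall x y z, D x y <= D x z + D z y;
  pseudometric_eq0 : forall x y, E x y -> D x y = 0 }.

Record is_metric (R : realType) (T : Type) (E : T -> T -> Prop)
    (D : T -> T -> R) : Prop := IsMetric {
  metric_pseudometric : is_pseudometric E D;
  metric_separated : forall x y, D x y = 0 -> E x y }.

(** A [probability] is a set function defined on all subsets; only its values
    on measurable sets are meaningful, so this is equality of measures. *)
Definition eq_prob d (T : measurableType d) (R : realType)
    (P Q : probability T R) : Prop :=
  forall A, measurable A -> P A = Q A.

(** ** Lebesgue measure on R^n *)

Section lebesgue_tuple.
Context (R : realType).

Definition cons_swap n (x : Euclid R n * measurableTypeR R) : Euclid R n.+1 :=
  [the n.+1.-tuple R of x.2 :: x.1].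

Lemma measurable_cons_swap n : measurable_fun setT (@cons_swap n).
Proof. exact: measurable_cons. Qed.

(** The image under [cons_swap] of the product of the n-dimensional and the
    one-dimensional Lebesgue measures. *)
Fixpoint lebesgue_tuple n : {measure set (Euclid R n) -> \bar R} :=
  match n with
  | 0 => @dirac _ (Euclid R 0) [tuple] R
  | m.+1 => measure_function_pushforward__canonical__measure_function_Measure
      (lebesgue_tuple m \x (@lebesgue_measure R))%E (@measurable_cons_swap m)
  end.

End lebesgue_tuple.

Lemma lebesgue_tuple_box (R : realType) n (A : 'I_n -> set R) :
  (forall i, measurable (A i)) ->
  lebesgue_tuple R n [set x | forall i, A i (tnth x i)] =
  (\prod_(i < n) lebesgue_measure (A i))%E.
Proof.
elim: n A => [A _|n IH A mA] /=.
  by rewrite big_ord0 diracE mem_set//= => -[].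
rewrite /pushforward.
have mB : measurable
    [set x : Euclid R n | forall i, A (lift ord0 i) (tnth x i)].
  rewrite (_ : [set _ | _] =
    \bigcap_(i in [set: 'I_n]) (tnth (T := R))^~ i @^-1` A (lift ord0 i)).
    apply: fin_bigcap_measurable => // i _; rewrite -[X in measurable X]setTI.
    by apply: measurable_tnth => //; exact: mA.
  by apply/seteqP; split=> x /= h i => [_|]; exact: h.
rewrite (_ : _ @^-1` _ = [set x : Euclid R n | forall i, A (lift ord0 i) (tnth x i)]
    `*` A ord0); last first.
  apply/seteqP; split=> -[x y] /=.
    by move=> h; split=> [i|]; [have := h (lift ord0 i); rewrite tnthS | exact: (h ord0)].
  move=> [h h0] i; case: (unliftP ord0 i) => [j ->|-> //].
  by rewrite tnthS.
rewrite product_measure1E//; last exact: (mA ord0).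
rewrite big_ord_recl muleC; congr (_ * _)%E.
by apply: IH => i; exact: mA.
Qed.

(** ** Uniform distribution on a subset of R^n *)

Section uniform.
Context (R : realType) (n : nat).
Implicit Types (A U Omega : set (Euclid R n)) (x y : Euclid R n) (s delta : R).

Definition euclid_dist x y : R :=
  Num.sqrt (\sum_(i < n) (tnth x i - tnth y i) ^+ 2).

(** [-oo] when [U] is empty. *)
Definition diam U : \bar R :=
  ereal_sup [set z | exists x y, [/\ U x, U y & z = (euclid_dist x y)%:E]].

(** Since [0 `^ 0 = 1], the 0-dimensional Hausdorff measure is the counting
    measure. *)
Definition diam_pow s U : \bar R :=
  if U == set0 then 0%E else poweR (diam U) s.

Definition hausdorff_pre s delta A : \bar R :=
  ereal_inf [set z | exists U : (set (Euclid R n))^nat,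
    [/\ A `<=` \bigcup_k U k, forall k, (diam (U k) <= delta%:E)%E &
        z = (\sum_(k <oo) diam_pow s (U k))%E]].

Definition hausdorff s A : \bar R :=
  ereal_sup [set hausdorff_pre s delta A | delta in [set delta | 0 < delta]].

(** Uniformity is relative to the Hausdorff measure of the dimension [s] of
    [Omega], so as to cover both [Omega] with nonempty interior ([s = n],
    normalised Lebesgue measure) and lower-dimensional ones such as the unit
    sphere ([s = n - 1], normalised surface measure). The usual dimensional
    constants cancel out in the quotient. *)
Definition is_uniform Omega (P : probability (Euclid R n) R) : Prop :=
  exists s, [/\ 0 <= s, (0 < hausdorff s Omega)%E,
    (hausdorff s Omega < +oo)%E &
    forall A, measurable A ->
      P A = (hausdorff s (A `&` Omega) * ((fine (hausdorff s Omega))^-1)%:E)%E].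

End uniform.

(** ** Probability densities on X and the measures they define *)

Record density (R : realType) d (X : set (Euclid R d)) := Density {
  density_fun :> Euclid R d -> R;
  measurable_density : measurable_fun X density_fun;
  density_ge0 : forall x, X x -> 0 <= density_fun x;
  integral_density :
    (\int[lebesgue_tuple R d]_(x in X) (density_fun x)%:E = 1)%E }.

(** Densities are functions up to Lebesgue-null sets. *)
Definition eq_density (R : realType) d (X : set (Euclid R d))
    (p q : density X) : Prop :=
  {ae lebesgue_tuple R d, forall x, X x -> p x = q x}.

Section law.
Context (R : realType) (d : nat) (X : set (Euclid R d)) (mX : measurable X).
Variable p : density X.

Definition law (_ : measurable X) (A : set (Euclid R d)) : \bar R :=
  (\int[lebesgue_tuple R d]_(x in A `&` X) (p x)%:E)%E.

Let law0 : law mX set0 = 0%E.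
Proof. by rewrite /law set0I integral_set0. Qed.

Let law_ge0 A : (0 <= law mX A)%E.
Proof.
by apply: integral_ge0 => x [_ Xx]; rewrite lee_fin; exact: density_ge0.
Qed.

Let law_sigma_additive : semi_sigma_additive (law mX).
Proof.
move=> F mF tF mUF; rewrite /law setI_bigcupl; apply: cvg_toP.
  apply: ereal_nondecreasing_is_cvgn => m n mn.
  apply: lee_sum_nneg_natr => // k _ _; exact: law_ge0.
rewrite ge0_integral_bigcup//=.
- by move=> k; exact: measurableI.
- apply: (measurable_funS mX); first by move=> x [k _ []].
  by apply/measurable_EFinP; exact: measurable_density.
- by move=> x [k _ [_ Xx]]; rewrite lee_fin; exact: density_ge0.
- exact: trivIset_setIr.
Qed.

HB.instance Definition _ := isMeasure.Build _ _ _ (law mX)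
  law0 law_ge0 law_sigma_additive.

Let law_setT : law mX setT = 1%E.
Proof. by rewrite /law setTI integral_density. Qed.

HB.instance Definition _ :=
  Measure_isProbability.Build _ _ _ (law mX) law_setT.

End law.

(** ** Parametric defining functions, slices *)

Record defining_function (R : realType) d n
    (X : set (Euclid R d)) (Omega : set (Euclid R n)) := DefiningFunction {
  defining_fun :> Euclid R n -> Euclid R d -> R;
  measurable_defining : forall theta, Omega theta ->
    measurable_fun X (defining_fun theta);
  bounded_defining : forall theta, Omega theta ->
    exists M : R, forall x, X x -> `|defining_fun theta x| <= M }.

Section slice.
Context (R : realType) (d n : nat).
Context (X : set (Euclid R d)) (Omega : set (Euclid R n)).
Variable f : defining_function X Omega.

(** The value 0 off [X] and off [Omega] plays no role: [law] is carried by [X],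
    and slices are only considered for parameters in [Omega]. *)
Definition extend (_ : measurable X) (theta : Euclid R n) :
    Euclid R d -> R :=
  if theta \in Omega then f theta \_ X else cst 0.

Hypothesis mX : measurable X.

Let measurable_extend theta : measurable_fun setT (extend mX theta).
Proof.
rewrite /extend; case: ifPn => [/set_mem Ot|_]; last exact: measurable_cst.
by apply/(measurable_restrictT _ mX); exact: measurable_defining.
Qed.

HB.instance Definition _ theta :=
  isMeasurableFun.Build _ _ _ _ (extend mX theta) (measurable_extend theta).

(** The slice of [p] with respect to [f theta], as a probability measure: the
    pushforward of the law of [p]. *)
Definition slice (p : density X) (theta : Euclid R n) :
    probability R R :=
  distribution (law p mX) (extend mX theta).

Lemma sliceE (p : density X) theta (B : set R) : Omega theta ->
  slice p theta B =
  (\int[lebesgue_tuple R d]_(x in f theta @^-1` B `&` X) (p x)%:E)%E.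
Proof.
move=> Ot; rewrite /slice /= /distribution /pushforward /law; congr integral.
apply/seteqP; split=> x /= []; rewrite /extend mem_set// => + Xx.
  by rewrite patchE mem_set.
by move=> Bfx; split => //; rewrite patchE mem_set.
Qed.

(** The generalized Radon transform: the family of all slices of [p]. *)
Definition grt (p : density X) : Euclid R n -> probability R R :=
  fun theta => slice p theta.

(** Equality of two families of slices indexed by [Omega], up to a null set of
    parameters. *)
Definition eq_slices (P : probability (Euclid R n) R)
    (u v : Euclid R n -> probability R R) : Prop :=
  {ae P, forall theta, Omega theta -> eq_prob (u theta) (v theta)}.

(** Injectivity as an operator between function spaces: on both sides, functions
    are identified when they agree almost everywhere. Identifying slices for all
    [theta] instead would be too weak a hypothesis for [gspm] to separate
    densities, as these could be told apart by a null set of parameters only. *)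
Definition grt_injective (P : probability (Euclid R n) R) : Prop :=
  forall p q : density X, eq_slices P (grt p) (grt q) -> eq_density p q.

(** [+oo] when the integral diverges. *)
Definition gspm (P : probability (Euclid R n) R)
    (xi : probability R R -> probability R R -> R)
    (r : R) (p q : density X) : \bar R :=
  poweR (\int[P]_(theta in Omega)
           ((xi (slice p theta) (slice q theta)) `^ r)%:E)%E r^-1.

End slice.

(* Main.v *)
(** Extended by zero off [Omega], the map
    [theta |-> xi (slice p theta) (slice q theta)] is a measurable function on
    the parameter space whose [L^r] norm is the GSPM. The triangle inequality is
    that of [xi] followed by Minkowski's inequality. A vanishing norm forces the
    slices to agree almost everywhere, and injectivity of the transform then
    identifies the densities. *)

Require Import Defs.
From mathcomp Require Import all_boot all_order all_algebra.
From mathcomp Require Import all_classical all_reals all_analysis.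
From mathcomp Require Import measurable_realfun.

Import Order.TTheory GRing.Theory Num.Theory.
Import numFieldNormedType.Exports.

Local Open Scope classical_set_scope.
Local Open Scope ring_scope.

(** Both [t ^ r] and [t ^ (1/r)] are nondecreasing on nonnegative arguments, and so is the integral.
    This carries the pointwise triangle inequality of [xi] over to norms. *)
Lemma le_Lnorm (d : measure_display) (T : measurableType d) (R : realType)
    (mu : {measure set T -> \bar R}) (r : R) (f g : T -> R) :
  0 <= r -> measurable_fun setT f -> measurable_fun setT g ->
  (forall x, `|f x| <= `|g x|) ->
  ('N[mu]_r%:E[EFin \o f] <= 'N[mu]_r%:E[EFin \o g])%E.
Proof.
move=> r0 mf mg fg.
have mpow (h : T -> R) : measurable_fun setT h ->
    measurable_fun setT (fun x => (`|(EFin \o h) x| `^ r)%E).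
  move=> mh; apply/measurable_EFinP.
  apply: (measurableT_comp (measurable_powR r)).
  exact: measurableT_comp.
rewrite unlock /Lnorm; apply: gt0_ler_poweR.
- by rewrite invr_ge0.
- by rewrite in_itv/= leey andbT integral_ge0// => x _; exact: poweR_ge0.
- by rewrite in_itv/= leey andbT integral_ge0// => x _; exact: poweR_ge0.
- apply: ge0_le_integral => //.
  + by move=> x _; exact: poweR_ge0.
  + exact: mpow.
  + exact: mpow.
  + by move=> x _ /=; rewrite lee_fin ge0_ler_powR// nnegrE.
Qed.

(** Extending [g] by zero off [D] leaves the integral unchanged because [0 ^ r = 0], which requires
    [r != 0] as [0 ^ 0 = 1]. The GSPM thereby becomes an [L^r] norm on the whole parameter space. *)
Lemma integral_powR_Lnorm (d : measure_display) (T : measurableType d)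
    (R : realType) (mu : {measure set T -> \bar R}) (D : set T) (r : R)
    (g : T -> R) :
  r != 0 -> (forall x, D x -> 0 <= g x) ->
  poweR (\int[mu]_(x in D) (g x `^ r)%:E)%E r^-1 =
  'N[mu]_r%:E[EFin \o (g \_ D)]%E.
Proof.
move=> r0 g0; rewrite unlock /Lnorm integral_mkcond; congr poweR.
apply: eq_integral => x _ /=; rewrite !patchE.
case: ifPn => [/set_mem Dx|_]; first by rewrite ger0_norm ?g0.
by rewrite normr0 powR0.
Qed.

(** Both slices measure [B] by integrating a density over the same part of [X], where the integrands
    agree almost everywhere. The equality thus holds at every [theta] of [Omega]. *)
Lemma eq_density_slice (R : realType) (d n : nat) (X : set (Euclid R d))
    (mX : measurable X) (Omega : set (Euclid R n))
    (f : defining_function X Omega) (p q : density X) (theta : Euclid R n) :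
  Omega theta -> eq_density p q ->
  eq_prob (slice f mX p theta) (slice f mX q theta).
Proof.
move=> Ot pq B mB; rewrite !sliceE//.
have mBX : measurable (f theta @^-1` B `&` X).
  by rewrite setIC; exact: measurable_defining.
have subX : f theta @^-1` B `&` X `<=` X by move=> x [].
have mdens (h : density X) :
    measurable_fun (f theta @^-1` B `&` X) (fun x => (h x)%:E).
  apply: (measurable_funS mX subX).
  by apply/measurable_EFinP; exact: measurable_density.
apply: ge0_ae_eq_integral => //.
- by move=> x [_ Xx]; rewrite lee_fin; exact: density_ge0.
- by move=> x [_ Xx]; rewrite lee_fin; exact: density_ge0.
- by apply: filterS pq => x pqx [_ Xx]; rewrite pqx.
Qed.

Theorem mainTheorem2 (R : realType) (d n : nat) (hd : (2 <= d)%N)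
  (X : set (Euclid R d)) (mX : measurable X)
  (Omega : set (Euclid R n)) (mOmega : measurable Omega)
  (Omega_neq0 : ~ Omega [tuple of nseq n (0 : R)])
  (P : probability (Euclid R n) R) (P_uniform : is_uniform Omega P)
  (f : defining_function X Omega)
  (xi : probability R R -> probability R R -> R)
  (xi_metric : is_metric (@eq_prob _ R R) xi)
  (r : R) (hr : 1 <= r)
  (xi_slice_measurable : forall p q : density X,
     measurable_fun Omega
       (fun theta => xi (slice f mX p theta) (slice f mX q theta))) :
  let zeta := gspm f mX P xi r in
  [/\ forall p q, (0 <= zeta p q)%E,
      forall p q, zeta p q = zeta q p,
      forall p q h, (zeta p q <= zeta p h + zeta h q)%E &
      forall p q, eq_density p q -> zeta p q = 0%E] /\
  (grt_injective f mX P -> forall p q, zeta p q = 0%E -> eq_density p q) /\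
  ((forall p q, (zeta p q < +oo)%E) ->
     (grt_injective f mX P ->
        is_metric (@eq_density R d X) (fun p q => fine (zeta p q))) /\
     (~ grt_injective f mX P ->
        is_pseudometric (@eq_density R d X) (fun p q => fine (zeta p q)))).
Proof.
have [xi_pm xi_sep] := xi_metric.
have [xi_ge0 xi_sym xi_tri xi_eq0] := xi_pm.
have r_gt0 : 0 < r by exact: lt_le_trans ltr01 hr.
move=> zeta.
pose g p q := (fun theta => xi (slice f mX p theta) (slice f mX q theta)) \_ Omega.
have zetaE p q : zeta p q = 'N[P]_r%:E[EFin \o g p q]%E.
  by apply: integral_powR_Lnorm => [|theta _]; rewrite ?gt_eqF.
have mg p q : measurable_fun setT (g p q).
  by apply/(measurable_restrictT _ mOmega); exact: xi_slice_measurable.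
have g_ge0 p q theta : 0 <= g p q theta.
  by rewrite /g patchE; case: ifP.
have zeta_ge0 p q : (0 <= zeta p q)%E by exact: poweR_ge0.
have zeta_sym p q : zeta p q = zeta q p.
  rewrite /zeta /gspm; congr poweR; apply: eq_integral => theta _.
  by rewrite xi_sym.
have zeta_tri p q h : (zeta p q <= zeta p h + zeta h q)%E.
  (* Minkowski bounds the norm of [g p h + g h q]; it remains to dominate [g p q] pointwise by this
     sum, using [xi_tri] on [Omega] and [0 <= 0 + 0] off it. *)
  rewrite !zetaE; apply: le_trans (minkowski_EFin P (mg p h) (mg h q) hr).
  apply: le_Lnorm => //; first exact: ltW.
    exact: measurable_funD.
  move=> theta; rewrite !ger0_norm ?addr_ge0 //= /g !patchE.
  by case: ifP => // _; rewrite addr0.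
have zeta_eq0 p q : eq_density p q -> zeta p q = 0%E.
  move=> pq; rewrite zetaE (_ : _ \o _ = cst 0%E) ?Lnorm0// ?eqe ?gt_eqF//.
  apply/funext => theta /=; rewrite /g patchE; case: ifPn => // /set_mem Ot.
  by rewrite xi_eq0//; exact: eq_density_slice.
have zeta_sep : grt_injective f mX P ->
    forall p q, zeta p q = 0%E -> eq_density p q.
  move=> inj p q; rewrite zetaE => N0; apply: inj.
  have mEg : measurable_fun setT (EFin \o g p q) by exact/measurable_EFinP.
  (* A zero norm makes [g p q] vanish [P]-almost everywhere. On [Omega] this means [xi] is zero
     there, so [xi_sep] gives exactly [eq_slices]. *)
  have := Lnorm_eq0_eq0 mEg (_ : (0 < r%:E)%E) N0.
  rewrite lte_fin => /(_ r_gt0); apply: filterS => theta /(_ I) /= [].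
  by rewrite /g patchE => + Ot; rewrite mem_set// => /xi_sep.
split; first by split.
split; first exact: zeta_sep.
move=> zeta_fin.
have zeta_num p q : zeta p q \is a fin_num by rewrite ge0_fin_numE.
have zeta_pm : is_pseudometric (@eq_density R d X) (fun p q => fine (zeta p q)).
  split=> [p q|p q|p q h|p q pq].
  - exact: fine_ge0.
  - by rewrite zeta_sym.
  - by rewrite -fineD// fine_le// fin_numD !zeta_num.
  - by rewrite zeta_eq0.
split=> [inj|_]; last exact: zeta_pm.
split=> // p q zpq; apply: zeta_sep => //.
(* Since [fine] also sends infinite values to 0, finiteness of [zeta p q] is what lifts
   [fine (zeta p q) = 0] to [zeta p q = 0]. *)
by rewrite -[zeta p q]fineK// zpq.
Qed.
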